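(* Let $p<0$, $-1<a<0$, let $n$ be a positive integer and let $k\in\{1,2,\dots,n-1\}$. Then the polynomial $K_n(x;p,a+k)$ is discrete quasi-orthogonal of order $k$ on $(0,\infty)$ with respect to the weight function $$w(x)=\frac{p^x(-a)_x}{(p-1)^x\,x!},\qquad x=0,1,2,\dots.$$
   Context: The Pochhammer symbol is $(\alpha)_0=1$ and $(\alpha)_m=\alpha(\alpha+1)\cdots(\alpha+m-1)$ for $m\ge 1$. For $n\in\{0,1,2,\dots\}$, $a\in\mathbb{R}$ and real $p\neq 0$, the (generalized) Krawtchouk polynomial is the polynomial of degree $n$ in $x$ given by $$K_n(x;p,a)=\sum_{k=0}^n\frac{(-n)_k(-x)_k(-a+k)_{n-k}}{k!\,p^k}.$$ A polynomial $P_n$ of exact degree $n\ge r$ is called discrete quasi-orthogonal of order $r$ with respect to a weight function $w$ on the nonnegative integers if $\sum_{x=0}^{\infty}x^jP_n(x)w(x)=0$ for $j=0,1,\dots,n-r-1$ and $\sum_{x=0}^{\infty}x^{j}P_n(x)w(x)\neq 0$ for $j=n-r$. ''On $(0,\infty)$'' refers to summation over the mass points $x=0,1,2,\dots$. *)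

(* Defs.v *)
From mathcomp Require Import all_boot all_order all_algebra.
From mathcomp Require Import all_classical all_reals all_analysis.

Set Implicit Arguments.
Unset Strict Implicit.
Unset Printing Implicit Defensive.

Import Order.TTheory GRing.Theory Num.Theory.
Import numFieldNormedType.Exports.

Local Open Scope classical_set_scope.
Local Open Scope ring_scope.

(* Stated over an arbitrary ring because it is used both for scalars and for
   the polynomial (-x)_k, i.e. [pochhammer (- 'X) k]. *)
Definition pochhammer (A : nzRingType) (alpha : A) (m : nat) : A :=
  \prod_(i < m) (alpha + i%:R).

Definition krawtchouk (R : realType) (n : nat) (p a : R) : {poly R} :=
  \sum_(k < n.+1)
    (pochhammer (- n%:R) k * pochhammer (- a + k%:R) (n - k)
       / (k`!%:R * p ^+ k)) *: pochhammer (- 'X) k.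

Lemma horner_krawtchouk (R : realType) (n : nat) (p a x : R) :
  (krawtchouk n p a).[x] =
  \sum_(k < n.+1)
    pochhammer (- n%:R) k * pochhammer (- x) k * pochhammer (- a + k%:R) (n - k)
      / (k`!%:R * p ^+ k).
Proof.
rewrite /krawtchouk horner_sum; apply: eq_bigr => k _.
rewrite hornerZ /pochhammer horner_prod.
under eq_bigr do rewrite hornerD hornerN hornerX -polyC_natr hornerC.
by rewrite mulrAC; congr (_ / _); rewrite mulrAC.
Qed.

Definition krawtchouk_weight (R : realType) (p a : R) (x : nat) : R :=
  p ^+ x * pochhammer (- a) x / ((p - 1) ^+ x * x`!%:R).

(* An infinite sum is the limit of its partial sums; its convergence is part of
   the property. *)
Definition discrete_quasi_orthogonal (R : realType) (w : nat -> R)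
    (n r : nat) (P : {poly R}) : Prop :=
  let moment_term j := fun x : nat => x%:R ^+ j * P.[x%:R] * w x in
  [/\ size P = n.+1, (r <= n)%N,
      forall j : nat, (j < n - r)%N ->
        series (moment_term j) @ \oo --> (0 : R)
    & exists2 l : R, l != 0 & series (moment_term (n - r)%N) @ \oo --> l].

(* Main.v *)
Require Import Defs.
From mathcomp Require Import all_boot all_order all_algebra.
From mathcomp Require Import all_classical all_reals all_analysis.
From mathcomp Require Import ring lra.

Import Order.TTheory GRing.Theory Num.Theory.
Import numFieldNormedType.Exports.

Local Open Scope ring_scope.

(** Put [c = p / (p - 1)], which lies in [0, 1) because [p < 0].  The weight is
    then the negative binomial term [c ^ x (-a)_x / x!], whose sum [F(-a)] is
    positive, and [F(alpha) = (1 - c) F(alpha + 1)].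

    Powers of [x] are the wrong test functions for this weight; the monic basis
    [(-a + x)_m] is the right one, because both it and the factor [(-x)_j] that
    occurs in the Krawtchouk polynomial are absorbed by the weight: the factor
    [(-x)_j] shifts the summation index and [(-a + x)_m] raises the parameter.
    This gives the closed form
      [sum_x (-x)_j (-a + x)_m w(x) = p^j (-a)_(j+m) (1 - p)^m F(-a)]
    ([cvg_series_ffact_pochhammer]).

    With [gamma = -(a + k)], the moment of the Krawtchouk polynomial against
    [(-a + x)_m] is therefore, up to nonzero factors,
      [sum_j (-1)^j C(n, j) (gamma + j)_(k + m)],
    the [n]-th finite difference of a polynomial of degree [k + m].  It is zero
    for [m < n - k] and [(-1)^n n!] for [m = n - k]
    ([alternating_sum_pochhammer], [cvg_series_krawtchouk_moment]).  The
    Pochhammer symbols of [gamma] among the factors do not vanish, because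
    [-1 < a < 0] prevents [gamma] from being an integer.

    Finally a triangular change of basis transfers these values from
    [(-a + x)_m] to [x^m] ([cvg_series_monic_basis]); the limit at [m = n - k]
    is unchanged because both bases are monic. *)

(** * Pochhammer symbols *)

Lemma pochhammer0 {A : nzRingType} (alpha : A) : pochhammer alpha 0 = 1.
Proof. by rewrite /pochhammer big_ord0. Qed.

Lemma pochhammerSr {A : nzRingType} (alpha : A) m :
  pochhammer alpha m.+1 = pochhammer alpha m * (alpha + m%:R).
Proof. by rewrite /pochhammer big_ord_recr. Qed.

Lemma pochhammerD {A : nzRingType} (alpha : A) m n :
  pochhammer alpha (m + n) = pochhammer alpha m * pochhammer (alpha + m%:R) n.
Proof.
elim: n => [|n IHn]; first by rewrite addn0 pochhammer0 mulr1.
by rewrite addnS !pochhammerSr IHn natrD !addrA mulrA.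
Qed.

Lemma pochhammerSl {A : nzRingType} (alpha : A) m :
  pochhammer alpha m.+1 = alpha * pochhammer (alpha + 1) m.
Proof. by rewrite -add1n pochhammerD pochhammerSr pochhammer0 mul1r addr0. Qed.

Lemma pochhammer_oppr_nat {A : nzRingType} (x m : nat) :
  pochhammer (- x%:R : A) m = (-1) ^+ m * (x ^_ m)%:R.
Proof.
elim: m => [|m IHm]; first by rewrite pochhammer0 ffactn0 mul1r.
rewrite pochhammerSr IHm ffactnSr natrM exprSr -!mulrA; congr (_ * _).
have [lt_xm|le_mx] := ltnP x m; first by rewrite ffact_small // !mul0r mulr0.
by rewrite natrB // mulrA mulN1r mulNr -mulrN opprB addrC.
Qed.

Lemma pochhammer_ge0 {R : realType} (alpha : R) m :
  0 <= alpha -> 0 <= pochhammer alpha m.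
Proof. by move=> alpha_ge0; apply: prodr_ge0 => i _; rewrite addr_ge0. Qed.

Lemma horner_pochhammer {R : realType} (q : {poly R}) m x :
  (pochhammer q m).[x] = pochhammer q.[x] m.
Proof.
rewrite /pochhammer horner_prod; apply: eq_bigr => i _.
by rewrite hornerD -polyC_natr hornerC.
Qed.

Lemma pochhammer_addXE {R : realType} (beta : R) m :
  pochhammer (beta%:P + 'X) m = \prod_(i < m) ('X - (- (beta + i%:R))%:P).
Proof.
rewrite /pochhammer; apply: eq_bigr => i _.
by rewrite polyCN opprK polyCD polyC_natr addrA [_%:P + 'X]addrC.
Qed.

Lemma size_pochhammer_addX {R : realType} (beta : R) m :
  size (pochhammer (beta%:P + 'X) m) = m.+1.
Proof.
by rewrite pochhammer_addXE size_prod_XsubC [index_enum _]unlock -enumT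
  size_enum_ord.
Qed.

Lemma coef_pochhammer_addX {R : realType} (beta : R) m :
  (pochhammer (beta%:P + 'X) m)`_m = 1.
Proof.
have /monicP := monic_prod_XsubC (index_enum 'I_m) xpredT
  (fun i : 'I_m => - (beta + i%:R)).
by rewrite -pochhammer_addXE lead_coefE size_pochhammer_addX.
Qed.

Lemma size_pochhammer_oppX {R : realType} m :
  size (pochhammer (- 'X : {poly R}) m) = m.+1.
Proof.
have -> : pochhammer (- 'X : {poly R}) m =
    (-1) ^+ m * \prod_(i < m) ('X - (i%:R)%:P).
  rewrite -[X in _ ^+ X]card_ord -prodrN; apply: eq_bigr => i _.
  by rewrite polyC_natr opprB addrC.
by rewrite size_Msign size_prod_XsubC [index_enum _]unlock -enumT size_enum_ord.
Qed.

(** * The degree of the Krawtchouk polynomial *)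

Lemma size_krawtchouk {R : realType} n (p a : R) :
  p != 0 -> size (krawtchouk n p a) = n.+1.
Proof.
move=> p0; rewrite /krawtchouk big_ord_recr /= subnn pochhammer0 mulr1.
have c0 : pochhammer (- n%:R : R) n / (n`!%:R * p ^+ n) != 0.
  rewrite pochhammer_oppr_nat ffactnn.
  by rewrite !mulf_neq0 ?invr_eq0 ?mulf_neq0 ?signr_eq0 ?expf_neq0 //
    pnatr_eq0 -lt0n fact_gt0.
rewrite addrC size_polyDl size_scale ?size_pochhammer_oppX //.
rewrite ltnS (leq_trans (size_sum _ _ _)) //; apply/bigmax_leqP => i _.
by rewrite (leq_trans (size_scale_leq _ _)) // size_pochhammer_oppX.
Qed.

(** * Finite differences of Pochhammer symbols *)

(** The difference operator acts on Pochhammer symbols as differentiation acts on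
    powers, [(gamma)_m - (gamma + 1)_m = - m (gamma + 1)_(m-1)], so iterating it
    by Pascal's rule gives a closed form. *)
Lemma alternating_sum_pochhammer {R : realType} (n m : nat) (gamma : R) :
  \sum_(j < n.+1) (-1) ^+ j * 'C(n, j)%:R * pochhammer (gamma + j%:R) m =
  (-1) ^+ n * (m ^_ n)%:R * pochhammer (gamma + n%:R) (m - n).
Proof.
elim: n m gamma => [|n IHn] m gamma.
  by rewrite big_ord_recl big_ord0 /= bin0 ffactn0 subn0 !mul1r addr0.
rewrite big_ord_recl /= bin0.
under eq_bigr => i _ do
  rewrite /bump /= add1n binS natrD mulrDr mulrDl exprS mulN1r.
rewrite big_split /= addrA; set S1 := (X in _ + X + _); set S2 := (X in _ + X).
have -> : S2 = - \sum_(j < n.+1)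
    (-1) ^+ j * 'C(n, j)%:R * pochhammer (gamma + 1 + j%:R) m.
  rewrite /S2 -sumrN; apply: eq_bigr => i _.
  by rewrite -natr1 [_ + 1]addrC addrA !mulNr.
have -> : (-1) ^+ 0 * 1 * pochhammer (gamma + 0%:R) m + S1 =
    \sum_(j < n.+1) (-1) ^+ j * 'C(n, j)%:R * pochhammer (gamma + j%:R) m.
  rewrite big_ord_recl /= bin0 /S1 big_ord_recr /= bin_small // mulr0 mul0r.
  congr (_ + _); rewrite addr0; apply: eq_bigr => i _.
  by rewrite /bump /= add1n exprS mulN1r.
rewrite -sumrB {S1 S2}.
case: m => [|m].
  rewrite big1 ?mulr0 ?mul0r // => i _.
  by rewrite !pochhammer0 subrr.
transitivity (- m.+1%:R * \sum_(j < n.+1)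
    (-1) ^+ j * 'C(n, j)%:R * pochhammer (gamma + 1 + j%:R) m).
  rewrite mulr_sumr; apply: eq_bigr => i _.
  rewrite -mulrBr pochhammerSl pochhammerSr addrAC.
  by rewrite -natr1; ring.
rewrite IHn ffactSS subSS natrM exprS -[n.+1%:R]natr1 [n%:R + 1]addrC addrA.
by ring.
Qed.

(** * Series with negative binomial terms *)

Local Open Scope classical_set_scope.

Lemma cvg_series_lincomb {R : realType} {I : Type} (s : seq I) (b l : I -> R)
    (f : I -> nat -> R) :
  (forall i, series (f i) @ \oo --> l i) ->
  series (fun x => \sum_(i <- s) b i * f i x) @ \oo -->
    \sum_(i <- s) b i * l i.
Proof.
move=> fl; elim: s => [|i s IHs].
  rewrite big_nil (_ : series _ = cst 0); first exact: cvg_cst.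
  by apply/funext => N; rewrite /series /= big1 // => x _; rewrite big_nil.
rewrite big_cons (_ : series _ = (fun N => b i * series (f i) N +
    series (fun x => \sum_(i <- s) b i * f i x) N)).
  by apply: cvgD => //; apply: cvgM => //; apply: cvg_cst.
apply/funext => N; rewrite /series /= mulr_sumr -big_split /=.
by apply: eq_bigr => x _; rewrite big_cons.
Qed.

Definition negbinom_term {R : realType} (c alpha : R) (x : nat) : R :=
  c ^+ x * pochhammer alpha x / x`!%:R.

Lemma negbinom_term_ge0 {R : realType} (c alpha : R) x :
  0 <= c -> 0 <= alpha -> 0 <= negbinom_term c alpha x.
Proof.
by move=> c0 a0; rewrite divr_ge0 // mulr_ge0 ?exprn_ge0 // pochhammer_ge0.
Qed.

(** Summation of the termwise relation
    [t(alpha, x) = t(alpha + 1, x) - c t(alpha + 1, x - 1)].  The last term is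
    kept, so that the identity also yields the boundedness of the sums at
    [alpha + 1] from that of the sums at [alpha]. *)
Lemma series_negbinom_term {R : realType} (c alpha : R) (N : nat) :
  series (negbinom_term c alpha) N.+1 =
  (1 - c) * series (negbinom_term c (alpha + 1)) N.+1
  + c * negbinom_term c (alpha + 1) N.
Proof.
elim: N => [|N IHN].
  rewrite /series /= !big_nat1 /negbinom_term !pochhammer0 fact0 expr0.
  by field.
rewrite seriesSr IHN [in RHS]seriesSr.
suff -> : negbinom_term c alpha N.+1 =
    negbinom_term c (alpha + 1) N.+1 - c * negbinom_term c (alpha + 1) N.
  by ring.
rewrite /negbinom_term pochhammerSl pochhammerSr factS natrM exprS.
have N0 : (N`!%:R : R) != 0 by rewrite pnatr_eq0 -lt0n fact_gt0.
have : (N.+1%:R : R) != 0 by rewrite pnatr_eq0.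
rewrite -natr1 => N1.
by field; rewrite N0 N1.
Qed.

(** For [alpha <= 1] one has [(alpha)_x <= x!], so the geometric series of ratio
    [c] dominates.  The sum is at least its first term [1]. *)
Lemma cvg_series_negbinom_term {R : realType} (c alpha : R) :
  0 <= c < 1 -> 0 <= alpha <= 1 ->
  exists2 F : R, 0 < F & series (negbinom_term c alpha) @ \oo --> F.
Proof.
move=> /andP[c0 c1] /andP[a0 a1].
have cF : cvgn (series (negbinom_term c alpha)).
  apply: (@series_le_cvg _ _ (geometric 1 c)) => [x|x|x|].
  - exact: negbinom_term_ge0.
  - by rewrite /= mul1r exprn_ge0.
  - rewrite /= mul1r /negbinom_term ler_pdivrMr ?ltr0n ?fact_gt0 //.
    rewrite ler_wpM2l ?exprn_ge0 //.
    elim: x => [|x IHx]; first by rewrite pochhammer0 fact0.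
    rewrite pochhammerSr factS natrM mulrC ler_pM ?addr_ge0 ?pochhammer_ge0 //.
    by rewrite -[x.+1%:R]natr1 addrC lerD2l.
  - by apply: is_cvg_geometric_series; rewrite ger0_norm.
exists (limn (series (negbinom_term c alpha))) => //.
rewrite (lt_le_trans ltr01) //.
have -> : 1 = series (negbinom_term c alpha) 1.
  by rewrite /series /= big_nat1 /negbinom_term pochhammer0 fact0 !mul1r invr1.
apply: nondecreasing_cvgn_le => //.
by apply: nondecreasing_series => x _ _; exact: negbinom_term_ge0.
Qed.

(** Larger parameters are reached one unit at a time, dividing the sum by [1 - c]
    at each step; this gives the sum in terms of [F] without real powers. *)
Lemma cvg_series_negbinom_term_shift {R : realType} (c alpha F : R) (m : nat) :
  0 <= c < 1 -> 0 <= alpha ->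
  series (negbinom_term c alpha) @ \oo --> F ->
  series (negbinom_term c (alpha + m%:R)) @ \oo --> F / (1 - c) ^+ m.
Proof.
move=> c01; elim: m alpha F => [|m IHm] alpha F a0 aF.
  by rewrite addr0 expr0 divr1.
have /andP[c0 c1] := c01.
rewrite -natr1 [m%:R + 1]addrC addrA exprS invfM mulrA.
apply: IHm; first by rewrite addr_ge0.
have ge0 x : 0 <= negbinom_term c (alpha + 1) x.
  by rewrite negbinom_term_ge0 ?addr_ge0.
have c1' : 0 < 1 - c by rewrite subr_gt0.
have nd : nondecreasing_seq (series (negbinom_term c alpha)).
  by apply: nondecreasing_series => x _ _; exact: negbinom_term_ge0.
(* The recurrence bounds the partial sums at [alpha + 1] by [F / (1 - c)]. *)
have cS : cvgn (series (negbinom_term c (alpha + 1))).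
  apply: nondecreasing_is_cvgn; first exact: nondecreasing_series.
  exists (F / (1 - c)) => _ [N _ <-].
  rewrite (@le_trans _ _ (series (negbinom_term c (alpha + 1)) N.+1)) //.
    by rewrite seriesSr lerDl.
  rewrite ler_pdivlMr // mulrC.
  rewrite (@le_trans _ _ (series (negbinom_term c alpha) N.+1)) //.
    by rewrite (series_negbinom_term _ alpha) lerDl mulr_ge0.
  by rewrite -(cvg_lim _ aF) //; apply: nondecreasing_cvgn_le => //; apply: cvgP aF.
have t0 := cvg_series_cvg_0 cS.
rewrite -(cvg_shiftS (series _)).
rewrite (_ : (fun n => series _ n.+1) = (fun N => (series (negbinom_term c alpha) N.+1
    - c * negbinom_term c (alpha + 1) N) / (1 - c))); last first.
  by apply/funext => N /=; rewrite series_negbinom_term addrK mulrC mulKf ?gt_eqF.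
rewrite -[F]subr0 -[X in F - X](mulr0 c).
apply: cvgM; last exact: cvg_cst.
apply: cvgB; first by rewrite (cvg_shiftS (series _)).
by apply: cvgM => //; exact: cvg_cst.
Qed.

(** * Moments *)

(** The first [j] terms vanish with [(-x)_j]; writing
    [x = j + y], the quotient [(-x)_j / x!] becomes [(-1)^j / y!], and the
    product of Pochhammer symbols regroups as
    [(beta)_(j+m) (beta + j + m)_y]. *)
Lemma cvg_series_ffact_pochhammer {R : realType} (c beta F : R) (j m : nat) :
  0 <= c < 1 -> 0 <= beta ->
  series (negbinom_term c beta) @ \oo --> F ->
  series (fun x => pochhammer (- x%:R) j * pochhammer (beta + x%:R) m
                   * negbinom_term c beta x) @ \oo -->
    (- c / (1 - c)) ^+ j * pochhammer beta (j + m) * (F / (1 - c) ^+ m).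
Proof.
move=> c01 b0 bF.
set f := fun x : nat => _.
have f0 x : (x < j)%N -> f x = 0.
  by move=> xj; rewrite /f pochhammer_oppr_nat ffact_small // mulr0 !mul0r.
have fE y : f (j + y)%N = (- c) ^+ j * pochhammer beta (j + m)
    * negbinom_term c (beta + (j + m)%:R) y.
  rewrite /f /negbinom_term pochhammer_oppr_nat.
  have <- := ffact_fact (leq_addr y j); rewrite addKn natrM.
  have ff : ((j + y) ^_ j)%:R != 0 :> R.
    by rewrite pnatr_eq0 -lt0n ffact_gt0 leq_addr.
  have yf : y`!%:R != 0 :> R by rewrite pnatr_eq0 -lt0n fact_gt0.
  have E : pochhammer beta (j + y) * pochhammer (beta + (j + y)%:R) m =
      pochhammer beta (j + m) * pochhammer (beta + (j + m)%:R) y.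
    by rewrite -!pochhammerD addnAC.
  rewrite exprD [(- c) ^+ j]exprNn.
  transitivity ((-1) ^+ j * c ^+ j * c ^+ y / y`!%:R *
    (pochhammer beta (j + y) * pochhammer (beta + (j + y)%:R) m)).
    by field; rewrite ff yf.
  by rewrite E; ring.
rewrite -(cvg_shiftn j).
rewrite (_ : (fun n => series _ (n + j)%N) = fun N => ((- c) ^+ j * pochhammer beta (j + m))
    * series (negbinom_term c (beta + (j + m)%:R)) N).
  rewrite exprMn exprVn.
  have -> : (- c) ^+ j / (1 - c) ^+ j * pochhammer beta (j + m) * (F / (1 - c) ^+ m)
     = (- c) ^+ j * pochhammer beta (j + m) * (F / (1 - c) ^+ (j + m)).
    rewrite exprD invfM; ring.
  apply: cvgM; first exact: cvg_cst.
  exact: cvg_series_negbinom_term_shift.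
apply/funext => N; rewrite /series /= (@big_cat_nat _ _ _ j) //= ?leq_addl //.
rewrite big_nat big1 ?add0r => [|x /andP[_ /f0]//].
rewrite -{1}[j]add0n big_addn addnK mulr_sumr.
by apply: eq_bigr => y _; rewrite addnC fE.
Qed.

(** If all moments against a monic basis [q] vanish below degree [d] and the
    [d]-th one is [l], then the moment functional is [l] times the coefficient
    of degree [d] on all polynomials of degree at most [d]. *)
Lemma cvg_series_monic_basis {R : realType} (w : nat -> R) (P : {poly R})
    (q : nat -> {poly R}) (d : nat) (l : R) :
  (forall m, size (q m) = m.+1) -> (forall m, (q m)`_m = 1) ->
  (forall m, (m <= d)%N -> series (fun x => (q m).[x%:R] * P.[x%:R] * w x) @ \oo -->
     (if m == d then l else 0)) ->
  forall Q : {poly R}, (size Q <= d.+1)%N ->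
  series (fun x => Q.[x%:R] * P.[x%:R] * w x) @ \oo --> Q`_d * l.
Proof.
move=> sq mq hq.
suff H s (Q : {poly R}) : (s <= d.+1)%N -> (size Q <= s)%N ->
    series (fun x => Q.[x%:R] * P.[x%:R] * w x) @ \oo --> Q`_d * l.
  by move=> Q; exact: H.
elim: s Q => [|s IHs] Q sd sQ.
  have -> : Q = 0 by apply/eqP; rewrite -size_poly_eq0 -leqn0.
  rewrite coef0 mul0r (_ : series _ = cst 0); first exact: cvg_cst.
  by apply/funext => N; rewrite /series /= big1 // => x _; rewrite horner0 !mul0r.
(* Subtracting the leading multiple of [q s] lowers the degree. *)
pose Q' := Q - Q`_s *: q s.
have sQ' : (size Q' <= s)%N.
  apply/leq_sizeP => i; rewrite leq_eqVlt => /orP[/eqP <-|si].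
    by rewrite coefB coefZ mq mulr1 subrr.
  rewrite coefB coefZ.
  by rewrite (nth_default _ (leq_trans sQ si)) [(q s)`_i]nth_default ?sq // mulr0 subr0.
have -> : Q`_d * l = Q'`_d * l + Q`_s * (if s == d then l else 0).
  rewrite coefB coefZ; case: eqP => [->|/eqP sd']; first by rewrite mq; ring.
  have lt_sd : (s < d)%N by rewrite ltn_neqAle sd'.
  by rewrite (nth_default _ (_ : size (q s) <= d)%N) ?sq //; ring.
rewrite (_ : series _ = (fun N => series (fun x => Q'.[x%:R] * P.[x%:R] * w x) N +
    Q`_s * series (fun x => (q s).[x%:R] * P.[x%:R] * w x) N)).
  apply: cvgD; first by apply: IHs => //; exact: ltnW.
  by apply: cvgM; [exact: cvg_cst|exact: hq].
apply/funext => N; rewrite /series /= mulr_sumr -big_split /=.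
apply: eq_bigr => x _; rewrite /Q' hornerD hornerN hornerZ; ring.
Qed.

Lemma ratio_bounds {R : realType} (p : R) : p < 0 -> 0 <= p / (p - 1) < 1.
Proof.
move=> p_lt0; have p1 : p - 1 < 0 by lra.
by rewrite ltW ?nmulr_rgt0 ?invr_lt0 //= ltr_ndivrMr // mul1r; lra.
Qed.

Lemma krawtchouk_weightE {R : realType} (p a : R) :
  krawtchouk_weight p a = negbinom_term (p / (p - 1)) (- a).
Proof.
apply/funext => x; rewrite /krawtchouk_weight /negbinom_term exprMn exprVn.
by rewrite invfM; ring.
Qed.

(** Both sides are [(gamma)_n (gamma)_(j+k+m)] divided by
    [(gamma)_j (gamma)_k].  The point is that [j] enters the right-hand side
    only through one Pochhammer symbol whose length does not depend on [j]. *)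
Lemma pochhammer_contiguous {R : realType} (gamma : R) (n k j m : nat) :
  (forall i, pochhammer gamma i != 0) -> (j <= n)%N ->
  pochhammer (gamma + j%:R) (n - j) * pochhammer (gamma + k%:R) (j + m) =
  pochhammer gamma n / pochhammer gamma k * pochhammer (gamma + j%:R) (k + m).
Proof.
move=> g0 jn; apply: (mulfI (g0 j)); apply: (mulfI (g0 k)).
have E : pochhammer gamma k * pochhammer (gamma + k%:R) (j + m) =
    pochhammer gamma j * pochhammer (gamma + j%:R) (k + m).
  by rewrite -!pochhammerD addnCA.
rewrite -{2}(subnKC jn) (pochhammerD gamma j (n - j)).
transitivity (pochhammer gamma j * pochhammer (gamma + j%:R) (n - j) *
  (pochhammer gamma k * pochhammer (gamma + k%:R) (j + m))); first by ring.
by rewrite E; field; rewrite g0.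
Qed.

(** The [j]-th summand of the Krawtchouk
    polynomial contributes [p ^+ j] through its mixed moment, which cancels its
    own [p ^- j]; [pochhammer_contiguous] then leaves an [n]-th finite
    difference of a Pochhammer symbol of degree [k + m].  The factor
    [(k + m) ^_ n] is what makes the order of quasi-orthogonality exactly [k]:
    it vanishes for [m < n - k] and not for [m = n - k]. *)
Lemma cvg_series_krawtchouk_moment {R : realType} (p a F : R) (n k m : nat) :
  let gamma := - (a + k%:R) in
  p < 0 -> a <= 0 -> (forall i, pochhammer gamma i != 0) ->
  series (krawtchouk_weight p a) @ \oo --> F ->
  series (fun x => (pochhammer ((- a)%:P + 'X) m).[x%:R] *
    (krawtchouk n p (a + k%:R)).[x%:R] * krawtchouk_weight p a x) @ \oo -->
  F * (1 - p) ^+ m * (pochhammer gamma n / pochhammer gamma k) *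
    ((-1) ^+ n * ((k + m) ^_ n)%:R * pochhammer (gamma + n%:R) (k + m - n)).
Proof.
move=> gamma p_lt0 a_le0 gamma0; rewrite krawtchouk_weightE => cvgF.
have p0 : p != 0 by rewrite lt_eqF.
have c01 := ratio_bounds p p_lt0.
set c := p / (p - 1) in cvgF c01 *.
have cE : (1 - c)^-1 = 1 - p by rewrite /c; field; lra.
have cpE : - c / (1 - c) = p by rewrite cE /c; field; lra.
have gammak : gamma + k%:R = - a by rewrite /gamma; ring.
rewrite -alternating_sum_pochhammer mulr_sumr.
pose b (j : 'I_n.+1) := (-1) ^+ j * 'C(n, j)%:R
  * pochhammer (gamma + j%:R) (n - j) / p ^+ j.
rewrite (eq_bigr (fun j : 'I_n.+1 => b j *
    ((- c / (1 - c)) ^+ j * pochhammer (- a) (j + m) * (F / (1 - c) ^+ m)))).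
  have a_ge0 : 0 <= - a by rewrite oppr_ge0.
  have := cvg_series_lincomb (index_enum 'I_n.+1) b _ _
    (fun j : 'I_n.+1 => cvg_series_ffact_pochhammer _ _ _ j m c01 a_ge0 cvgF).
  set f := (f in series f); set g := (g in _ -> series g @ _ --> _).
  suff -> : f = g by [].
  apply/funext => x; rewrite /f /g horner_pochhammer hornerD hornerC hornerX.
  rewrite horner_krawtchouk mulr_sumr mulr_suml; apply: eq_bigr => j _.
  rewrite -/gamma (pochhammer_oppr_nat n) -bin_ffact natrM /b.
  by field; rewrite expf_neq0 // pnatr_eq0 -lt0n fact_gt0.
move=> j _; rewrite cpE -exprVn cE /b.
transitivity ((-1) ^+ j * 'C(n, j)%:R * (F * (1 - p) ^+ m) *
    (pochhammer (gamma + j%:R) (n - j) * pochhammer (- a) (j + m))).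
  by rewrite -gammak pochhammer_contiguous // -1?ltnS //; ring.
by field; rewrite expf_neq0.
Qed.

Theorem theorem3 (R : realType) (p a : R) (n k : nat)
    (hp : p < 0) (ha : -1 < a < 0) (hn : (0 < n)%N)
    (hk : (1 <= k <= n - 1)%N) :
  discrete_quasi_orthogonal (krawtchouk_weight p a) n k
    (krawtchouk n p (a + k%:R)).
Proof.
have /andP[a_gt a_lt] := ha.
have kn : (k <= n)%N by case/andP: hk => _ /leq_trans -> //; exact: leq_subr.
have a01 : 0 <= - a <= 1 by lra.
have [F F_gt0 cvgF] := cvg_series_negbinom_term _ _ (ratio_bounds p hp) a01.
rewrite -krawtchouk_weightE in cvgF.
pose gamma := - (a + k%:R).
(* A vanishing factor would make [a] an integer, strictly between [-1] and [0]. *)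
have gamma0 i : pochhammer gamma i != 0.
  apply/prodf_neq0 => j _; apply/eqP => gj.
  have {gj} : a = j%:R - k%:R by move: gj; rewrite /gamma => gj; lra.
  have [jk|kj] := ltnP j k.
    by have := jk; rewrite -(ler_nat R) -natr1 => ? ?; lra.
  by have := kj; rewrite -(ler_nat R) => ? ?; lra.
have momE m :=
  cvg_series_krawtchouk_moment p a F n k m hp (ltW a_lt) gamma0 cvgF.
pose l := F * (1 - p) ^+ (n - k) * (pochhammer gamma n / pochhammer gamma k) *
  ((-1) ^+ n * n`!%:R).
have mom_basis m : (m <= n - k)%N ->
    series (fun x => (pochhammer ((- a)%:P + 'X) m).[x%:R] *
      (krawtchouk n p (a + k%:R)).[x%:R] * krawtchouk_weight p a x) @ \oo -->
    if m == (n - k)%N then l else 0.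
  move=> m_le; have := momE m; case: eqP => [->|/eqP m_neq].
    by rewrite subnKC // subnn pochhammer0 ffactnn mulr1.
  rewrite ffact_small; first by rewrite mulr0 mul0r mulr0.
  by rewrite -ltn_subRL ltn_neqAle m_neq.
have mom_Xn (j : nat) : (j <= n - k)%N ->
    series (fun x => x%:R ^+ j * (krawtchouk n p (a + k%:R)).[x%:R]
      * krawtchouk_weight p a x) @ \oo -->
    if j == (n - k)%N then l else 0.
  move=> j_le; have := cvg_series_monic_basis _ _ _ _ l
    (size_pochhammer_addX (- a)) (coef_pochhammer_addX (- a)) mom_basis 'X^j.
  rewrite size_polyXn ltnS => /(_ j_le).
  rewrite coefXn [(n - k)%N == _]eq_sym -mulrb mulr_natl.
  by under [X in series X]funext do rewrite hornerXn.
split => //.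
- by apply: size_krawtchouk; rewrite lt_eqF.
- by move=> j j_lt; have := mom_Xn j (ltnW j_lt); rewrite ltn_eqF.
exists l; last by have := mom_Xn (n - k)%N (leqnn _); rewrite eqxx.
rewrite /l !mulf_neq0 ?invr_eq0 ?expf_neq0 ?gamma0 ?oppr_eq0 ?oner_eq0 //.
- by rewrite lt0r_neq0.
- by rewrite lt0r_neq0 //; lra.
Qed.
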